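(* Let $Q_0\subset\mathbb{R}^n$ be a fixed cube. (i) Let $1<p<n$ and let $p^{\ast}$ be defined by $\frac{1}{p^{\ast}}=\frac1p-\frac1n$. If $f\in S_p(Q_0)$, then $f\in L(p^{\ast},\infty)(Q_0)$. (ii) If $p=n$, then $f\in S_n(Q_0)$ implies that $f\in GaRo_\infty(Q_0)=BMO(Q_0)$.
   Context: All cubes have sides parallel to the coordinate axes. For a cube $Q$, $|Q|$ is its Lebesgue measure, $l(Q)$ is its side length, and $f_Q=\frac{1}{|Q|}\int_Q f\,dx$. For $p\in(1,\infty)$, the class $S_p(Q_0)$ consists of all functions $f\in L^1(Q_0)$ for which there exist a constant $c(f)>0$ and a function $g\in L^p(Q_0)$ such that for all subcubes $Q\subset Q_0$, $$\frac{1}{|Q|}\int_Q |f-f_Q|\,dx\le c(f)\,l(Q)\left\{\frac{1}{|Q|}\int_Q |g|^p\,dx\right\}^{1/p}.$$ (In part (ii), where $p=n$, the requirement $p\in(1,\infty)$ in this definition means $n\ge 2$.) For $1<q<\infty$, $L(q,\infty)(Q_0)$ is the weak-$L^q$ (Marcinkiewicz) space of measurable functions $f$ on $Q_0$ with $\|f\|_{L(q,\infty)}^{\ast}=\sup_{t>0} f^{\ast}(t)t^{1/q}<\infty$, where $f^{\ast}$ is the non-increasing rearrangement of $f$ (with respect to Lebesgue measure on $Q_0$). Let $P(Q_0)$ be the set of all countable families $\{Q_i\}_i$ of subcubes $Q_i\subset Q_0$ with pairwise disjoint interiors. The space $GaRo_\infty(Q_0)$ consists of all $f\in L^1(Q_0)$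 for which there is $C>0$ such that for all $\{Q_i\}_i\in P(Q_0)$, $$\sum_i\frac{1}{|Q_i|}\int_{Q_i}\int_{Q_i}|f(x)-f(y)|\,dx\,dy\le C\sum_i|Q_i|.$$ $BMO(Q_0)$ is the space of all $f\in L^1(Q_0)$ with $\sup_{Q\subset Q_0}\frac{1}{|Q|}\int_Q|f-f_Q|\,dx<\infty$, the supremum being over all subcubes $Q\subset Q_0$. The equality $GaRo_\infty(Q_0)=BMO(Q_0)$ is an equality of sets of functions. *)

(* Defs.v *)
From HB Require Import structures.
From mathcomp Require Import all_boot all_order all_algebra.
From mathcomp Require Import all_classical all_reals all_analysis.
From mathcomp Require Import measurable_realfun.

Set Implicit Arguments.
Unset Strict Implicit.
Unset Printing Implicit Defensive.
Import Order.TTheory GRing.Theory Num.Theory.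
Import numFieldNormedType.Exports.

Local Open Scope classical_set_scope.
Local Open Scope ring_scope.

Section lebesgue_outer.
Context {R : realType} {n : nat}.
Implicit Types (a b : 'rV[R]_n) (A B : set 'rV[R]_n).

Definition box a b : set 'rV[R]_n :=
  [set x | forall i, a ord0 i <= x ord0 i <= b ord0 i].

(* The box is empty, of volume 0, as soon as b i < a i for some i. *)
Definition box_vol a b : R :=
  \prod_(i < n) Num.max 0 (b ord0 i - a ord0 i).

(* Covers are indexed by a set D of naturals, i.e. are finite or countable; the
   empty cover is what makes the definition correct when n = 0. *)
Definition lebesgue_outer A : \bar R :=
  ereal_inf [set s | exists (D : set nat) (a b : nat -> 'rV[R]_n),
    A `<=` \bigcup_(k in D) box (a k) (b k) /\
    s = \esum_(k in D) (box_vol (a k) (b k))%:E]%E.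

Lemma box_vol_ge0 a b : 0 <= box_vol a b.
Proof. by apply: prodr_ge0 => i _; rewrite le_max lexx. Qed.

Lemma lebesgue_outer_ge0 A : (0 <= lebesgue_outer A)%E.
Proof.
apply: le_ereal_inf_tmp => _ [D [a [b [_ ->]]]].
by apply: esum_ge0 => k _; rewrite lee_fin box_vol_ge0.
Qed.

Lemma lebesgue_outer0 : lebesgue_outer set0 = 0%E.
Proof.
apply/eqP; rewrite eq_le lebesgue_outer_ge0 andbT.
apply: ereal_inf_lbound; exists set0, (fun=> 0), (fun=> 0).
by split => //; rewrite esum_set0.
Qed.

Lemma le_lebesgue_outer A B :
  A `<=` B -> (lebesgue_outer A <= lebesgue_outer B)%E.
Proof.
move=> AB; apply: ereal_inf_le_tmp => s [D [a [b [BU ->]]]].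
by exists D, a, b; split => //; exact: subset_trans BU.
Qed.

Lemma lebesgue_outer_sigma_subadditive : sigma_subadditive lebesgue_outer.
Proof.
move=> A; have [[i ioo]|] := pselect (exists i, lebesgue_outer (A i) = +oo%E).
  rewrite (eseries_pinfty _ _ ioo) ?leey// => k _.
  by rewrite -ltNye (lt_le_trans _ (lebesgue_outer_ge0 _)).
rewrite -forallNE => Aoo; apply/lee_addgt0Pr => e e0.
rewrite (le_trans _ (epsilon_trick _ _ (ltW e0)))//; last first.
  by move=> k; exact: lebesgue_outer_ge0.
pose P k (c : set nat * (nat -> 'rV[R]_n) * (nat -> 'rV[R]_n)) :=
  A k `<=` \bigcup_(j in c.1.1) box (c.1.2 j) (c.2 j) /\
  (\esum_(j in c.1.1) (box_vol (c.1.2 j) (c.2 j))%:E <=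
   lebesgue_outer (A k) + (e / (2 ^ k.+1)%:R)%:E)%E.
have [c Pc] : {c & forall k, P k (c k)}.
  apply: (@choice _ _ P) => k.
  have ek : 0 < e / (2 ^ k.+1)%:R by rewrite divr_gt0// ltr0n expn_gt0.
  have fA : lebesgue_outer (A k) \is a fin_num.
    by rewrite ge0_fin_numE ?lebesgue_outer_ge0// ltey; exact/eqP/Aoo.
  have [s [D [a [b [AD ->]]]] sA] := lb_ereal_inf_adherent ek fA.
  by exists (D, a, b); split => //=; exact: ltW.
pose D k := (c k).1.1.
pose v (p : nat * nat) := box_vol ((c p.1).1.2 p.2) ((c p.1).2 p.2).
have /ppcard_eqP[f] := card_nat2.
have fK p : f^-1%FUN (f p) = p by rewrite funK ?inE.
apply: (@le_trans _ _ (\esum_(p in [set: nat] `*`` D) (v p)%:E)).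
  apply: ereal_inf_lbound; exists (f @` ([set: nat] `*`` D)).
  exists (fun m => (c (f^-1%FUN m).1).1.2 (f^-1%FUN m).2).
  exists (fun m => (c (f^-1%FUN m).1).2 (f^-1%FUN m).2); split.
    move=> x [i _ /(Pc i).1[j Dj xj]].
    by exists (f (i, j)); [exists (i, j)|rewrite fK].
  rewrite esum_image.
    by apply: eq_esum => p _; rewrite fK.
  by move=> p q _ _ /(congr1 f^-1%FUN); rewrite !fK.
rewrite -(@esum_esum _ _ _ _ _ (fun i j => (v (i, j))%:E)); last first.
  by move=> i j _ _; rewrite lee_fin box_vol_ge0.
rewrite -nneseries_esumT; last first.
  by move=> i; apply: esum_ge0 => j _; rewrite lee_fin box_vol_ge0.
apply: lee_nneseries => i _.
  by move=> _; apply: esum_ge0 => j _; rewrite lee_fin box_vol_ge0.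
exact: (Pc i).2.
Qed.

HB.instance Definition _ := isOuterMeasure.Build R 'rV[R]_n lebesgue_outer
  lebesgue_outer0 lebesgue_outer_ge0 le_lebesgue_outer
  lebesgue_outer_sigma_subadditive.

End lebesgue_outer.

(* From here on, "measurable" in 'rV[R]_n means Lebesgue measurable. *)
HB.instance Definition _ (R : realType) (n : nat) :=
  @isMeasurable.Build (caratheodory_display (@lebesgue_outer R n)) 'rV[R]_n
    (@lebesgue_outer R n).-caratheodory
    (caratheodory_measurable_set0 (@lebesgue_outer R n))
    (@caratheodory_measurable_setC _ _ (@lebesgue_outer R n))
    (@caratheodory_measurable_bigcup _ _ (@lebesgue_outer R n)).

Definition lebesgue_rV (R : realType) (n : nat) : set 'rV[R]_n -> \bar R :=
  @lebesgue_outer R n.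

HB.instance Definition _ (R : realType) (n : nat) :=
  isMeasure.Build _ 'rV[R]_n R (@lebesgue_rV R n)
    (outer_measure0 (@lebesgue_outer R n))
    (outer_measure_ge0 (@lebesgue_outer R n))
    (@caratheodory_measure_sigma_additive R _ (@lebesgue_outer R n)).

Record cube (R : realType) (n : nat) := Cube {
  corner : 'rV[R]_n ;
  side : R ;
  side_gt0 : 0 < side }.

Definition cube_set (R : realType) (n : nat) (Q : cube R n) : set 'rV[R]_n :=
  [set x | forall i, corner Q ord0 i <= x ord0 i <= corner Q ord0 i + side Q].

Coercion cube_set : cube >-> set.

(* Functions on a cube Q0 are represented by total functions on 'rV[R]_n, whose
   values outside Q0 are never used. *)
Section function_classes.
Context {R : realType} {n : nat}.
Local Notation mu := (@lebesgue_rV R n).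
Implicit Types (Q : cube R n) (f g : 'rV[R]_n -> R) (p q : R).

Definition avg Q f : R := (fine (mu Q))^-1 * \int[mu]_(x in Q) f x.

Definition mean_osc Q f : R := avg Q (fun x => `|f x - avg Q f|).

Definition L1 Q : set ('rV[R]_n -> R) :=
  [set f : 'rV[R]_n -> R | mu.-integrable Q (EFin \o f)].

Definition Lp p Q : set ('rV[R]_n -> R) :=
  [set g : 'rV[R]_n -> R | measurable_fun Q g /\
    (\int[mu]_(x in Q) (`|g x| `^ p)%:E < +oo)%E].

Definition S_class p Q0 : set ('rV[R]_n -> R) :=
  [set f : 'rV[R]_n -> R | L1 Q0 f /\
    exists (c : R) g, [/\ 0 < c, Lp p Q0 g &
      forall Q, Q `<=` Q0 ->
        mean_osc Q f <=
        c * side Q * (avg Q (fun x => `|g x| `^ p)) `^ p^-1]].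

Definition distribution_fun Q0 f (s : R) : \bar R :=
  mu (Q0 `&` [set x | s < `|f x|]).

Definition rearrangement Q0 f (t : R) : \bar R :=
  ereal_inf [set s%:E | s in [set s : R |
    0 <= s /\ (distribution_fun Q0 f s <= t%:E)%E]].

Definition weakL_norm q Q0 f : \bar R :=
  ereal_sup [set (rearrangement Q0 f t * (t `^ q^-1)%:E)%E | t in
    [set t : R | 0 < t]].

Definition weakL q Q0 : set ('rV[R]_n -> R) :=
  [set f : 'rV[R]_n -> R | measurable_fun Q0 f /\ (weakL_norm q Q0 f < +oo)%E].

Definition disjoint_subcubes Q0 (D : set nat) (Q : nat -> cube R n) : Prop :=
  (forall k, D k -> Q k `<=` Q0) /\
  trivIset D (fun k => interior (Q k)).

Definition GaRo_infty Q0 : set ('rV[R]_n -> R) :=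
  [set f : 'rV[R]_n -> R | L1 Q0 f /\
    exists2 C : R, 0 < C & forall D (Q : nat -> cube R n),
      disjoint_subcubes Q0 D Q ->
      (\esum_(k in D) ((fine (mu (Q k)))^-1%:E *
         \int[mu]_(x in Q k) \int[mu]_(y in Q k) `|f x - f y|%:E) <=
       C%:E * \esum_(k in D) mu (Q k))%E].

Definition BMO Q0 : set ('rV[R]_n -> R) :=
  [set f : 'rV[R]_n -> R | L1 Q0 f /\
    (ereal_sup [set (mean_osc Q f)%:E | Q in
      [set Q : cube R n | Q `<=` Q0]] < +oo)%E].

End function_classes.

(* Main.v *)
Require Import Defs.
From mathcomp Require Import all_boot all_order all_algebra.
From mathcomp Require Import all_classical all_reals all_analysis.
From mathcomp Require Import measurable_realfun.
From mathcomp Require Import ring lra.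

Set Implicit Arguments.
Unset Strict Implicit.
Unset Printing Implicit Defensive.
Import Order.TTheory GRing.Theory Num.Theory.

Local Open Scope classical_set_scope.
Local Open Scope ring_scope.

(** Part (ii) is elementary.  A cube of side h has volume h ^ n, so for p = n
    the factor l(Q) cancels the normalisation of the average of |g| ^ n, and
    the oscillation of f on Q is at most c times the L ^ n norm of g
    ([S_class_BMO]).  The equality of GaRo_infty and BMO holds cube by cube:
    the double integral of |f x - f y| over Q x Q lies between |Q| and 2 |Q|
    times the integral of |f - f_Q|, and both bounds follow by integrating the
    triangle inequality in one variable at a time ([mean_osc_le_double],
    [double_le_mean_osc]).

    Part (i) is a good-lambda argument.  Let E be the set where |f| > t and E'
    the set where |f| > 2 t.  If t is large, E has density at most
    2 ^ - (n + 1) in Q0, and E is covered up to a null set by disjoint dyadic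
    cubes Q, each chosen maximal among those in which E has density more than
    2 ^ - (n + 1).  The parent of such a Q has low density, so E fills at most
    half of Q.  Hence |f| <= t on a part of Q at least as large as the part
    where |f| > 2 t, and whatever the value of f_Q, it is at distance at least
    t / 2 from f on one of them; thus |E' & Q| is at most 2 / t times the integral of
    |f - f_Q| over Q ([level_sets_dev]).  The hypothesis on f bounds this
    integral by c |Q| ^ (1 + 1 / n) (avg |g| ^ p) ^ (1 / p).  Since |Q| is at
    most W = 2 ^ (n + 1) |E|, Young's inequality with a well-chosen parameter
    turns the bound into a combination of |E & Q| and of the integral of
    |g| ^ p over Q, which is additive in Q ([stopping_domination]).  Summing
    gives, with lambda (t) = |E| and 1 / q = 1 / p - 1 / n,
      lambda (2 t) <= (K / t) lambda (t) ^ (1 - 1 / q)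
    ([S_class_level_decay]).  This inequality propagates the bound
    lambda (t) <= M t ^ (- q) from t to 2 t as soon as M is large
    ([weak_decay_iteration]), and such a bound is the weak-type estimate.

    The measure enters through three facts.  The volume of a box is its outer
    measure, which is proved by slicing a countable cover and integrating over
    the last coordinate ([le_prod_of_cover], [lebesgue_box]).  Boxes are
    measurable, because a half-space cuts every box into two boxes
    ([measurable_halfspace]).  Finally, a set whose density in every dyadic
    cube is at most some fixed t < 1 is null ([density_null]).  This weak form of
    the density theorem follows from the definition of the outer measure by box
    covers, and it shows that the stopped cubes cover E up to a null set. *)

(** * Volume of boxes *)

(** The slice of the big box at height t of the last coordinate is covered by
    the slices of those boxes of the cover whose last side contains t.
    Integrating the inequality for slices over t and exchanging sum and
    integral gives the inequality in one more dimension.  The flag [c k] says that box k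
    belongs to the cover: it changes with t in the induction. *)
Lemma le_prod_of_cover (R : realType) (m : nat) (a b : nat -> R)
    (c : nat -> bool) (u v : nat -> nat -> R) :
  (forall i, (i < m)%N -> a i <= b i) ->
  (forall x : nat -> R, (forall i, (i < m)%N -> a i <= x i <= b i) ->
     exists2 k, c k & forall i, (i < m)%N -> u k i <= x i <= v k i) ->
  ((\prod_(i < m) (b i - a i))%:E <=
   \sum_(0 <= k <oo) ((c k)%:R * \prod_(i < m) Num.max 0 (v k i - u k i))%:E)%E.
Proof.
elim: m c => [|m IH] c ab cov.
  have [k ck _] := cov a (fun i (h : (i < 0)%N) => ltac:(by [])).
  rewrite (nneseries_split 0 k.+1)//; last first.
    by move=> j _; rewrite lee_fin mulr_ge0 ?ler0n ?prodr_ge0// => i _; rewrite le_max lexx.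
  rewrite big_ord0 add0n big_nat_recr//= ck big_ord0 mul1r.
  apply: (@le_trans _ _ ((0 + 1%:E) + 0)%E); first by rewrite add0e adde0.
  apply: leeD; [apply: leeD => //; apply: sume_ge0 => j _|apply: nneseries_ge0 => j _ _];
    by rewrite lee_fin mulr_ge0 ?ler0n ?prodr_ge0// => i _; rewrite le_max lexx.
set P := \prod_(i < m) (b i - a i).
pose V k := \prod_(i < m) Num.max 0 (v k i - u k i).
have V0 k : 0 <= V k by apply: prodr_ge0 => i _; rewrite le_max lexx.
pose J : set R := `[a m, b m]%classic.
pose I k : set R := `[u k m, v k m]%classic.
have mlen (x y : R) : lebesgue_measure (`[x, y]%classic : set R) = (Num.max 0 (y - x))%:E.
  rewrite lebesgue_measure_itv/= lte_fin; case: ltP => xy.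
    by rewrite max_r ?subr_ge0 ?ltW// EFinB.
  by rewrite max_l// subr_le0.
have mJ : (R.-ocitv.-measurable).-sigma.-measurable J by exact: measurable_itv.
have mI k : (R.-ocitv.-measurable).-sigma.-measurable (I k) by exact: measurable_itv.
pose h k t : \bar R := ((c k)%:R * V k * \1_(I k) t)%:E.
have h0 k t : (0 <= h k t)%E by rewrite lee_fin !mulr_ge0 ?ler0n.
have slice t : J t -> (P%:E <= \sum_(0 <= k <oo) h k t)%E.
  move=> Jt.
  have := IH (fun k => c k && (t \in I k)).
  move=> /(_ (fun i im => ab i (ltnW im))) H.
  apply: (le_trans (H _)).
    move=> x xab; pose y i := if i == m then t else x i.
    have [i im|k ck ky] := cov y.
      rewrite /y; case: eqP => [->|ne]; first by move: Jt; rewrite /J/= in_itv.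
      by apply: xab; move: im; rewrite ltnS leq_eqVlt => /orP[/eqP|//].
    exists k.
      rewrite ck; apply/mem_set; rewrite /I/= in_itv/=.
      by have := ky m (ltnSn m); rewrite /y eqxx.
    by move=> i im; have := ky i (ltnW im); rewrite /y (ltn_eqF im).
  apply: lee_nneseries => k _.
    by move=> _; rewrite lee_fin mulr_ge0 ?ler0n ?V0.
  rewrite lee_fin /h indicE mulrAC -/(V k).
  by case: (c k); case: (t \in I k); rewrite ?mul1r ?mul0r.
have mh k : measurable_fun J (h k).
  apply/measurable_EFinP; apply: measurable_funM => //; apply: measurable_indic; exact: mI.
rewrite big_ord_recr/= -/P.
apply: (@le_trans _ _ (\int[lebesgue_measure]_(t in J) \sum_(0 <= k <oo) h k t)%E).
  apply: (@le_trans _ _ (\int[lebesgue_measure]_(t in J) (cst P%:E t))%E).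
    rewrite integral_cst// (_ : _ J = (Num.max 0 (b m - a m))%:E); last exact: mlen.
    by rewrite -EFinM max_r// subr_ge0 ab.
  apply: ge0_le_integral => //.
  - move=> t _; rewrite lee_fin; apply: prodr_ge0 => i _.
    by rewrite subr_ge0 ab// ltnW// ltnS.
  - by apply: ge0_emeasurable_sum => [k t _ _|k _]; [exact: h0|exact: mh].
rewrite integral_nneseries//.
apply: lee_nneseries => k _; first by move=> _; apply: integral_ge0.
rewrite /h big_ord_recr/= mulrA -/(V k).
under eq_integral do rewrite EFinM.
rewrite ge0_integralZl_EFin//; last 2 first.
- by apply/measurable_EFinP; apply: measurable_indic; exact: mI.
- by rewrite mulr_ge0.
rewrite integral_indic; [|exact: mJ|exact: mI].
rewrite [leRHS]EFinM; apply: lee_pmul => //.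
- by rewrite lee_fin mulr_ge0.
- rewrite -(mlen (u k m) (v k m)).
  by apply: le_measure; rewrite ?inE//; apply: measurableI.
Qed.

Section box_measure.
Context {R : realType} {n : nat}.
Local Notation mu := (@lebesgue_rV R n).
Implicit Types (a b : 'rV[R]_n) (A : set 'rV[R]_n) (Q : cube R n).

Lemma lebesgue_box a b : mu (box a b) = (box_vol a b)%:E.
Proof.
apply/eqP; rewrite eq_le; apply/andP; split.
  apply: ereal_inf_lbound; exists [set 0%N], (fun=> a), (fun=> b); split.
    by move=> x abx; exists 0%N.
  by rewrite esum_set1// lee_fin box_vol_ge0.
have [[x abx]|bempty] := pselect (box a b !=set0); last first.
  suff -> : box_vol a b = 0 by exact: measure_ge0.
  have [i ba] : exists i, b ord0 i < a ord0 i.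
    apply/not_existsP => ab; apply: bempty; exists a => i.
    by rewrite lexx leNgt; apply/negP => /ab.
  by rewrite /box_vol (bigD1 i)//= max_l ?mul0r// subr_le0 ltW.
apply: le_ereal_inf_tmp => _ [D [u [v [cov ->]]]].
pose ext (w : 'rV[R]_n) (i : nat) : R := oapp (w ord0) 0 (insub i).
have extE w (i : 'I_n) : ext w i = w ord0 i by rewrite /ext valK.
have ab i : a ord0 i <= b ord0 i by have /andP[/le_trans] := abx i; exact.
have /= := @le_prod_of_cover R n (ext a) (ext b) (fun k => k \in D)
  (fun k => ext (u k)) (fun k => ext (v k)).
rewrite (_ : \prod_(i < n) _ = box_vol a b); last first.
  by apply: eq_bigr => i _; rewrite !extE max_r// subr_ge0.
move=> H; apply: (le_trans (H _ _)).
- by move=> i ilt; have := ab (Ordinal ilt); rewrite -!extE.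
- move=> y yab.
  have [|k Dk xk] := cov (\row_i y i).
    by move=> i; rewrite mxE -!extE; exact: yab.
  exists k; first exact: mem_set.
  by move=> i ilt; have := xk (Ordinal ilt); rewrite mxE -!extE.
rewrite nneseries_esumT; last first.
  by move=> k; rewrite lee_fin mulr_ge0// prodr_ge0// => i _; rewrite le_max lexx.
rewrite [leRHS]esum_mkcond; apply: le_esum => k _.
have -> : \prod_(i < n) Num.max 0 (ext (v k) i - ext (u k) i) = box_vol (u k) (v k).
  by apply: eq_bigr => i _; rewrite !extE.
by case: ifPn => Dk; rewrite ?mul1r ?mul0r ?lee_fin.
Qed.

(** A half-space cuts each box of a cover into two boxes whose volumes add up to
    the volume of the box. *)
Lemma measurable_halfspace (i : 'I_n) (t : R) :
  measurable [set x : 'rV[R]_n | x ord0 i <= t].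
Proof.
apply: le_caratheodory_measurable => X.
apply: le_ereal_inf_tmp => _ [D [u [v [cov ->]]]].
pose cut (w : 'rV[R]_n) (r : R) : 'rV[R]_n :=
  \row_j (if j == i then r else w ord0 j).
pose v' k := cut (v k) (Num.min (v k ord0 i) t).
pose u' k := cut (u k) (Num.max (u k ord0 i) t).
have cutE k : box_vol (u k) (v k) = box_vol (u k) (v' k) + box_vol (u' k) (v k).
  have volE w z : box_vol w z = Num.max 0 (z ord0 i - w ord0 i) *
      \prod_(j < n | j != i) Num.max 0 (z ord0 j - w ord0 j).
    by rewrite /box_vol (bigD1 i).
  rewrite !volE !mxE eqxx.
  have e1 : \prod_(j < n | j != i) Num.max 0 (v' k ord0 j - u k ord0 j) =
    \prod_(j < n | j != i) Num.max 0 (v k ord0 j - u k ord0 j).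
    by apply: eq_bigr => j /negbTE ji; rewrite mxE ji.
  have e2 : \prod_(j < n | j != i) Num.max 0 (v k ord0 j - u' k ord0 j) =
    \prod_(j < n | j != i) Num.max 0 (v k ord0 j - u k ord0 j).
    by apply: eq_bigr => j /negbTE ji; rewrite mxE ji.
  rewrite e1 e2 -mulrDl; congr (_ * _).
  move: (u k ord0 i) (v k ord0 i) => p q.
  case: (leP q t) => h1; case: (leP p t) => h2;
    case: (leP 0 (q - p)) => h3; case: (leP 0 (t - p)) => h4;
    case: (leP 0 (q - t)) => h5; try lra.
have -> : (\esum_(k in D) (box_vol (u k) (v k))%:E =
  \esum_(k in D) (box_vol (u k) (v' k))%:E +
  \esum_(k in D) (box_vol (u' k) (v k))%:E)%E.
  rewrite -esumD; last 2 first.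
  - by move=> k _; rewrite lee_fin box_vol_ge0.
  - by move=> k _; rewrite lee_fin box_vol_ge0.
  by apply: eq_esum => k _; rewrite cutE EFinD.
apply: leeD; apply: ereal_inf_lbound.
  exists D, u, v'; split=> // x [Xx /= xt].
  have [k Dk kx] := cov x Xx; exists k => // j; rewrite mxE.
  have := kx j; case: eqP => // -> /andP[-> h]/=.
  by rewrite le_min h.
exists D, u', v; split=> // x [Xx /= /negP].
rewrite -ltNge => /ltW tx.
have [k Dk kx] := cov x Xx; exists k => // j; rewrite mxE.
have := kx j; case: eqP => // -> /andP[h ->]/=.
by rewrite ge_max h tx.
Qed.

Lemma measurable_coord (i : 'I_n) (D : set 'rV[R]_n) :
  measurable_fun D (fun x : 'rV[R]_n => x ord0 i).
Proof.
suff : measurable_fun setT (fun x : 'rV[R]_n => x ord0 i) by exact: measurable_funTS.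
apply: (measurability _ (RGenOInfty.measurableE R)).
move=> _ [_ [t ->] <-]; rewrite setTI.
rewrite (_ : _ @^-1` _ = ~` [set x : 'rV[R]_n | x ord0 i <= t]).
  exact/measurableC/measurable_halfspace.
by apply/seteqP; split=> x /=; rewrite in_itv/= andbT ltNge => /negP.
Qed.

Lemma measurable_all_coord (P : 'I_n -> set R) : (forall i, measurable (P i)) ->
  measurable [set x : 'rV[R]_n | forall i, P i (x ord0 i)].
Proof.
move=> mP.
rewrite (_ : [set x | _] =
  \bigcap_(i in [set: 'I_n]) ((fun x : 'rV[R]_n => x ord0 i) @^-1` P i)).
  apply: fin_bigcap_measurable => // i _; rewrite -[X in measurable X]setTI.
  exact: measurable_coord.
by apply/seteqP; split=> x /= h i; [move=> _|]; exact: h.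
Qed.

Lemma measurable_box a b : measurable (box a b).
Proof.
apply: (@measurable_all_coord (fun i => `[a ord0 i, b ord0 i]%classic)) => i.
exact: measurable_itv.
Qed.

(** * Cubes *)

(** Half-open cubes: a grid of them is an exact partition, and the faces that
    distinguish them from closed cubes are null. *)
Definition hcube (Q : cube R n) : set 'rV[R]_n :=
  [set x | forall i, corner Q ord0 i <= x ord0 i < corner Q ord0 i + side Q].

Lemma cube_box Q : cube_set Q = box (corner Q) (\row_i (corner Q ord0 i + side Q)).
Proof. by apply/seteqP; split=> x /= h i; have := h i; rewrite mxE. Qed.

Lemma measurable_cube (Q : cube R n) : measurable Q.
Proof. by rewrite cube_box; exact: measurable_box. Qed.

Lemma lebesgue_cube (Q : cube R n) : mu Q = (side Q ^+ n)%:E.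
Proof.
rewrite cube_box lebesgue_box /box_vol; under eq_bigr do rewrite mxE addrC addKr.
by rewrite prodr_const card_ord max_r// ltW// side_gt0.
Qed.

Lemma measurable_hcube Q : measurable (hcube Q).
Proof.
apply: (@measurable_all_coord
  (fun i => `[corner Q ord0 i, corner Q ord0 i + side Q[%classic)) => i.
exact: measurable_itv.
Qed.

Lemma hcube_sub Q : hcube Q `<=` Q.
Proof. by move=> x h i; have /andP[-> /ltW ->] := h i. Qed.

Lemma lebesgue_cubeDhcube Q : mu (Q `\` hcube Q) = 0%E.
Proof.
pose b : 'rV[R]_n := \row_i (corner Q ord0 i + side Q).
pose a (k : nat) : 'rV[R]_n :=
  \row_j (if j == k :> nat then b ord0 j else corner Q ord0 j).
apply/eqP; rewrite eq_le measure_ge0 andbT.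
rewrite -(@esum1 _ _ `I_n (fun k => (box_vol (a k) b)%:E)); last first.
  move=> k /= kn; rewrite /box_vol (bigD1 (Ordinal kn))//= !mxE eqxx.
  by rewrite subrr maxxx mul0r.
apply: ereal_inf_lbound; exists `I_n, a, (fun=> b); split=> // x [Qx nQx].
have [i xi] : exists i, corner Q ord0 i + side Q <= x ord0 i.
  apply/not_existsP => H; apply: nQx => i; have /andP[-> _] := Qx i.
  by rewrite ltNge; apply/negP/H.
exists (nat_of_ord i); first exact: ltn_ord.
move=> j; rewrite !mxE; have /andP[h1 h2] := Qx j; rewrite h2 andbT.
by case: eqP => // /val_inj ->.
Qed.

Lemma lebesgue_setI_hcube (A : set 'rV[R]_n) Q : measurable A ->
  mu (A `&` hcube Q) = mu (A `&` Q).
Proof.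
move=> mA; have mQ := measurable_cube Q; have mh := measurable_hcube Q.
rewrite (_ : A `&` Q = (A `&` hcube Q) `|` (A `&` (Q `\` hcube Q))); last first.
  by rewrite -setIUr setDUK//; exact: hcube_sub.
rewrite measureU0//; [exact: measurableI|by apply: measurableI => //; exact: measurableD|].
apply/eqP; rewrite eq_le measure_ge0 andbT -(lebesgue_cubeDhcube Q).
by apply: le_measure; rewrite ?inE//; [apply: measurableI => //|]; exact: measurableD.
Qed.

Lemma lebesgue_hcube Q : mu (hcube Q) = (side Q ^+ n)%:E.
Proof.
by rewrite -[hcube Q]setTI lebesgue_setI_hcube// setTI lebesgue_cube.
Qed.

End box_measure.

(** * Oscillation, BMO and the Garsia-Rodemich space *)

(** The integral of a nonnegative function is the supremum of the integrals of
    the simple functions below it, so it is monotone for arbitrary functions.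
    It will be applied to the inner integral of a double integral, as a
    function of the outer variable. *)
Lemma ge0_le_integral_nonmeasurable d (T : measurableType d) (R : realType)
    (m : {measure set T -> \bar R}) (D : set T) (f1 f2 : T -> \bar R) :
  (forall x, D x -> 0 <= f1 x)%E -> (forall x, D x -> f1 x <= f2 x)%E ->
  (\int[m]_(x in D) f1 x <= \int[m]_(x in D) f2 x)%E.
Proof.
move=> f10 f12; rewrite !ge0_integralE//; last first.
  by move=> x Dx; exact: le_trans (f10 x Dx) (f12 x Dx).
apply: le_ereal_sup => _ [h hf1 <-]; exists h => // x.
apply: (le_trans (hf1 x)); rewrite !patchE; case: ifPn => // /set_mem; exact: f12.
Qed.

Section oscillation.
Context {R : realType} {n : nat}.
Local Notation mu := (@lebesgue_rV R n).
Implicit Types (Q : cube R n) (f g : 'rV[R]_n -> R).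

Lemma fine_cube Q : fine (mu Q) = side Q ^+ n.
Proof. by rewrite lebesgue_cube. Qed.

Lemma vol_gt0 Q : 0 < side Q ^+ n.
Proof. by rewrite exprn_gt0// side_gt0. Qed.

Lemma cube_fin Q : (mu Q < +oo)%E.
Proof. by rewrite lebesgue_cube ltry. Qed.

Lemma L1_sub Q0 Q f : Q `<=` Q0 -> L1 Q0 f -> L1 Q f.
Proof. by move=> QQ0; apply: integrableS => //; exact: measurable_cube. Qed.

Lemma integrable_cube_cst Q (c : R) : mu.-integrable Q (EFin \o cst c).
Proof.
apply/integrableP; split; first exact/measurable_EFinP.
rewrite (_ : (\int[mu]_(x in Q) _)%E = (\int[mu]_(x in Q) (cst `|c|%:E x))%E)//.
rewrite integral_cst; last exact: measurable_cube.
by rewrite /= lebesgue_cube -EFinM ltry.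
Qed.

Lemma L1_subr Q f (c : R) : L1 Q f -> L1 Q (fun x => f x - c).
Proof.
move=> fQ; apply: (eq_integrable (measurable_cube Q) ((EFin \o f) \- (EFin \o cst c))%E) => //.
by apply: integrableB => //; [exact: measurable_cube|exact: integrable_cube_cst].
Qed.

Lemma L1_dev Q f (c : R) : L1 Q f -> L1 Q (fun x => `|f x - c|).
Proof.
by move=> fQ; apply: integrable_norm; exact: L1_subr.
Qed.

Lemma avgE Q f : \int[mu]_(x in Q) f x = side Q ^+ n * avg Q f.
Proof. by rewrite /avg fine_cube mulrA mulfV ?mul1r// gt_eqF// vol_gt0. Qed.

Lemma L1_EFin Q f : L1 Q f -> (\int[mu]_(x in Q) (f x)%:E)%E = (\int[mu]_(x in Q) f x)%:E.
Proof.
by move=> fQ; rewrite fineK//; apply: integrable_fin_num => //; exact: measurable_cube.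
Qed.

(** f x - f_Q is the average of f x - f y over y in Q. *)
Lemma dev_avg_le Q f x : L1 Q f ->
  `|f x - avg Q f| * side Q ^+ n <= \int[mu]_(y in Q) `|f x - f y|.
Proof.
move=> fQ; have mQ := measurable_cube Q.
have fxQ : L1 Q (fun y => f x - f y).
  apply: (eq_integrable mQ ((EFin \o cst (f x)) \- (EFin \o f))%E) => //.
  by apply: integrableB => //; exact: integrable_cube_cst.
have := le_normr_Rintegral mQ fxQ; rewrite RintegralB//; last exact: integrable_cube_cst.
rewrite Rintegral_cst//= fine_cube avgE [_ * side _ ^+ _]mulrC -mulrBr normrM.
by rewrite [X in X * _]gtr0_norm ?vol_gt0// mulrC.
Qed.

Lemma L1_dist Q f x : L1 Q f -> L1 Q (fun y => `|f x - f y|).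
Proof.
move=> fQ; apply: (eq_integrable (measurable_cube Q) _ _ _ (L1_dev (f x) fQ)) => y _.
by rewrite /= distrC.
Qed.

Lemma mean_osc_le_double Q f : L1 Q f ->
  ((side Q ^+ n * (side Q ^+ n * mean_osc Q f))%:E <=
   \int[mu]_(x in Q) \int[mu]_(y in Q) `|f x - f y|%:E)%E.
Proof.
move=> fQ; have mQ := measurable_cube Q.
rewrite /mean_osc -avgE EFinM -L1_EFin; last exact: L1_dev.
rewrite -ge0_integralZl_EFin//; last 2 first.
- exact: measurable_int (L1_dev _ fQ).
- exact/ltW/vol_gt0.
apply: ge0_le_integral_nonmeasurable => x _.
  by rewrite -EFinM lee_fin mulr_ge0// ltW// vol_gt0.
by rewrite (L1_EFin (L1_dist x fQ)) -EFinM lee_fin mulrC dev_avg_le.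
Qed.

(** Integrate |f x - f y| <= |f x - f_Q| + |f y - f_Q| in y, then in x. *)
Lemma double_le_mean_osc Q f : L1 Q f ->
  (\int[mu]_(x in Q) \int[mu]_(y in Q) `|f x - f y|%:E <=
  (side Q ^+ n * (2 * (side Q ^+ n * mean_osc Q f)))%:E)%E.
Proof.
move=> fQ; have mQ := measurable_cube Q.
set V := side Q ^+ n; set J := V * mean_osc Q f.
have JE : \int[mu]_(x in Q) `|f x - avg Q f| = J by rewrite avgE.
have dQ := L1_dev (avg Q f) fQ.
have ctQ c := integrable_cube_cst Q c.
have vdQ : L1 Q (fun x => V * `|f x - avg Q f|).
  apply: (eq_integrable mQ _ _ _ (integrableZl mQ V dQ)) => y _; by rewrite /= EFinM.
apply: (@le_trans _ _ (\int[mu]_(x in Q) ((V * `|f x - avg Q f| + J)%:E))%E).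
  apply: ge0_le_integral_nonmeasurable => x _.
    by apply: integral_ge0 => y _; rewrite lee_fin.
  rewrite (L1_EFin (L1_dist x fQ)) lee_fin -JE.
  rewrite [X in X + _](_ : _ = \int[mu]_(y in Q) (cst `|f x - avg Q f| y)); last first.
    by rewrite Rintegral_cst//= fine_cube mulrC.
  rewrite -RintegralD//; apply: le_Rintegral => //.
  - exact: L1_dist.
  - apply: (eq_integrable mQ _ _ _ (integrableD mQ (ctQ `|f x - avg Q f|) dQ)) => y _.
    by rewrite /= EFinD.
  - by move=> y _ /=; rewrite (distrC (f y)); exact: ler_distD.
have vdJ : L1 Q (fun x => V * `|f x - avg Q f| + J).
  apply: (eq_integrable mQ _ _ _ (integrableD mQ vdQ (ctQ J))) => y _.
  by rewrite /= EFinD.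
rewrite (L1_EFin vdJ) lee_fin (RintegralD mQ vdQ (ctQ J)) (RintegralZl V mQ dQ).
rewrite JE Rintegral_cst// fine_cube -/V.
lra.
Qed.

Lemma mean_osc_ge0 Q f : 0 <= mean_osc Q f.
Proof.
rewrite /mean_osc {1}/avg fine_cube; apply: mulr_ge0; last exact: Rintegral_ge0.
by rewrite invr_ge0 ltW// vol_gt0.
Qed.

Lemma BMO_P Q0 f : BMO Q0 f <->
  L1 Q0 f /\ exists2 C : R, 0 < C & forall Q, Q `<=` Q0 -> mean_osc Q f <= C.
Proof.
split=> -[fQ0]; last first.
  move=> [C C0 oscC]; split => //; apply: (@le_lt_trans _ _ C%:E); last exact: ltry.
  by apply: ge_ereal_sup => _ [Q QQ0 <-]; rewrite lee_fin oscC.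
set S := ereal_sup _ => Soo; split=> //.
have ub Q : Q `<=` Q0 -> ((mean_osc Q f)%:E <= S)%E.
  by move=> QQ0; apply: ereal_sup_ubound; exists Q.
have S0 : (0 <= S)%E.
  by apply: le_trans (ub _ (@subset_refl _ Q0)); rewrite lee_fin mean_osc_ge0.
exists (fine S + 1); first by rewrite ltr_wpDl// fine_ge0.
move=> Q QQ0; have := ub Q QQ0; rewrite -[S]fineK ?ge0_fin_numE// lee_fin => /le_trans; apply.
by rewrite lerDl.
Qed.

(** A single cube is an admissible family, which gives one inclusion; the other
    one sums the bound for a cube over the family. *)
Theorem GaRo_infty_BMO Q0 : GaRo_infty Q0 = BMO Q0.
Proof.
apply/seteqP; split=> f.
  move=> [fQ0 [C C0 garo]]; apply/BMO_P; split=> //; exists C => // Q QQ0.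
  have := garo [set 0%N] (fun=> Q); rewrite !esum_set1//; last first.
    apply: mule_ge0; first by rewrite lee_fin invr_ge0 fine_ge0.
    by apply: integral_ge0 => x _; apply: integral_ge0 => y _; rewrite lee_fin.
  have dQ : disjoint_subcubes Q0 [set 0%N] (fun=> Q).
    by split=> // i j -> ->.
  move=> /(_ dQ); rewrite fine_cube lebesgue_cube => H.
  have V0 := vol_gt0 Q.
  have osc2 := mean_osc_le_double (L1_sub QQ0 fQ0).
  have Vi0 : (0 <= (side Q ^+ n)^-1%:E)%E by rewrite lee_fin invr_ge0 ltW.
  have := le_trans (lee_wpmul2l Vi0 osc2) H.
  by rewrite -!EFinM lee_fin mulKf ?gt_eqF// [leRHS]mulrC ler_pM2l.
move=> /BMO_P[fQ0 [C C0 oscC]]; split=> //; exists (2 * C); first by rewrite mulr_gt0.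
move=> D Q [QQ0 _]; apply: ge_ereal_sup => _ [F [finF FD] <-].
have C20 : (0 <= (2 * C)%:E)%E by rewrite lee_fin mulr_ge0// ltW.
apply: (@le_trans _ _ ((2 * C)%:E * \sum_(k \in F) mu (Q k))%E); last first.
  apply: lee_wpmul2l => //; apply: ereal_sup_ubound; exists F => //; by split.
rewrite ge0_mule_fsumr; last by move=> k; exact: measure_ge0.
apply: lee_fsum => // k Fk.
have Qk := QQ0 k (FD k Fk); have V0 := vol_gt0 (Q k).
have Vi0 : (0 <= (side (Q k) ^+ n)^-1%:E)%E by rewrite lee_fin invr_ge0 ltW.
rewrite fine_cube lebesgue_cube.
apply: (le_trans (lee_wpmul2l Vi0 (double_le_mean_osc (L1_sub Qk fQ0)))).
rewrite -!EFinM lee_fin mulKf ?gt_eqF// -mulrA ler_pM2l// mulrC ler_pM2r//.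
exact: oscC.
Qed.

Lemma powR_L1 p Q0 g : Lp p Q0 g -> L1 Q0 (fun x => `|g x| `^ p).
Proof.
move=> [mg gp]; apply/integrableP; split.
  apply/measurable_EFinP.
  apply: (@measurableT_comp _ _ _ _ _ _ (@powR R ^~ p) _ (fun x => `|g x|)).
    exact: measurable_powR.
  exact: measurableT_comp.
by under eq_integral do rewrite /= ger0_norm ?powR_ge0//.
Qed.

(** For p = n the side of Q cancels against |Q| ^ (1 / n), which leaves the
    L ^ n norm of g on Q0 as a bound for all oscillations. *)
Lemma S_class_BMO Q0 f : (0 < n)%N -> S_class n%:R Q0 f -> BMO Q0 f.
Proof.
move=> n0 [fQ0 [c [g [c0 gLp osc]]]]; apply/BMO_P; split=> //.
pose G := \int[mu]_(x in Q0) (`|g x| `^ n%:R).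
have gi := powR_L1 gLp.
exists (c * G `^ (n%:R^-1) + 1).
  by rewrite ltr_wpDl// mulr_ge0 ?powR_ge0// ltW.
move=> Q QQ0; apply: (le_trans (osc Q QQ0)); rewrite ler_wpDr//.
rewrite -mulrA ler_pM2l//.
have V0 := vol_gt0 Q; have l0 := side_gt0 Q.
rewrite /avg fine_cube powRM ?invr_ge0 ?(ltW V0)//; last first.
  by apply: Rintegral_ge0 => x _; exact: powR_ge0.
rewrite -exprVn -powR_mulrn ?invr_ge0 ?(ltW l0)// -powRrM mulfV ?pnatr_eq0 -?lt0n//.
rewrite powRr1 ?invr_ge0 ?(ltW l0)// mulrA mulfV ?gt_eqF// mul1r.
have Gle : \int[mu]_(x in Q) (`|g x| `^ n%:R) <= G.
  rewrite -lee_fin -!L1_EFin//; last exact: L1_sub gi.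
  apply: ge0_subset_integral => //; [exact: measurable_cube|exact: measurable_cube|].
  exact: measurable_int gi.
apply: ge0_ler_powR; rewrite ?invr_ge0 ?nnegrE//.
- by apply: Rintegral_ge0 => x _; exact: powR_ge0.
- by apply: Rintegral_ge0 => x _; exact: powR_ge0.
Qed.

End oscillation.

(** * Dyadic cubes and the stopping-time argument *)

Section dyadic.
Import numFieldNormedType.Exports.
Context {R : realType} {n : nat} (Q0 : cube R n).
Local Notation mu := (@lebesgue_rV R n).
Implicit Types (m : nat) (x y : 'rV[R]_n) (k : {ffun 'I_n -> int}) (E F S : set 'rV[R]_n).

Definition mesh m : R := side Q0 / 2 ^+ m.

Lemma mesh_gt0 m : 0 < mesh m.
Proof. by rewrite divr_gt0 ?side_gt0// exprn_gt0. Qed.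

Lemma meshS m : mesh m = 2 * mesh m.+1.
Proof. by rewrite /mesh exprS; field; rewrite expf_neq0. Qed.

(** The position of x in the grid of mesh [mesh m] anchored at the corner of Q0.
    Two points lie in the same half-open dyadic cube of generation m exactly
    when they have the same index. *)
Definition dyadic_index m x : {ffun 'I_n -> int} :=
  [ffun i => Num.floor ((x ord0 i - corner Q0 ord0 i) / mesh m)].

Definition dyadic_cube m k : cube R n :=
  Cube (\row_i (corner Q0 ord0 i + mesh m * (k i)%:~R)) (mesh_gt0 m).

Definition dyadic_cell m x := dyadic_cube m (dyadic_index m x).

Lemma mem_dyadic_cube m k x : hcube (dyadic_cube m k) x <-> dyadic_index m x = k.
Proof.
have h0 := mesh_gt0 m.
have E (k' : {ffun 'I_n -> int}) i : (corner Q0 ord0 i + mesh m * (k' i)%:~R <= x ord0 i <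
    corner Q0 ord0 i + mesh m * (k' i)%:~R + mesh m) =
    (Num.floor ((x ord0 i - corner Q0 ord0 i) / mesh m) == k' i).
  rewrite floor_eq ler_pdivlMr// ltr_pdivrMr// intrD mulrDl mul1r.
  by rewrite [_ * mesh m]mulrC lerBrDl ltrBlDl addrA.
split=> [H|<- i]; last by rewrite /= mxE E ffunE.
by apply/ffunP => i; rewrite ffunE; apply/eqP; rewrite -E; have := H i; rewrite /= mxE.
Qed.

Lemma dyadic_cellP m x y : hcube (dyadic_cell m x) y <-> dyadic_index m y = dyadic_index m x.
Proof. exact: mem_dyadic_cube. Qed.

Lemma dyadic_index0 x : hcube Q0 x <-> dyadic_index 0 x = [ffun=> 0].
Proof.
rewrite -mem_dyadic_cube; split=> H i; have := H i;
  by rewrite /= mxE ffunE mulr0 addr0 /mesh expr0 divr1.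
Qed.

(** Dyadic cubes are nested: floor (2 z) determines floor z. *)
Lemma dyadic_indexS m x y :
  dyadic_index m.+1 x = dyadic_index m.+1 y -> dyadic_index m x = dyadic_index m y.
Proof.
move=> /ffunP H; apply/ffunP => i; have := H i; rewrite !ffunE (meshS m).
have half z : z / mesh m.+1 = 2 * (z / (2 * mesh m.+1)).
  by field; rewrite gt_eqF// mesh_gt0.
rewrite !half.
move: (_ / _) (_ / _) => q p pq.
have e (j : int) : (2 * j)%:~R = 2 * j%:~R :> R by rewrite intrM.
apply/eqP; rewrite floor_eq.
have : 2 * Num.floor q <= Num.floor (2 * p).
  by rewrite pq floor_ge_int e ler_pM2l// floor_le.
have : Num.floor (2 * p) < 2 * (Num.floor q + 1).
  by rewrite pq floor_lt_int e ltr_pM2l// floorD1_gt.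
by rewrite floor_ge_int floor_lt_int !e ler_pM2l// ltr_pM2l// => -> ->.
Qed.

Lemma dyadic_index_le m m' x y : (m <= m')%N ->
  dyadic_index m' x = dyadic_index m' y -> dyadic_index m x = dyadic_index m y.
Proof.
move=> /subnKC <-; elim: (m' - m)%N => [|d IH]; first by rewrite addn0.
by rewrite addnS => /dyadic_indexS.
Qed.

Lemma dyadic_index_hcube m x y :
  hcube Q0 x -> dyadic_index m y = dyadic_index m x -> hcube Q0 y.
Proof.
move=> /dyadic_index0 x0 /(dyadic_index_le (leq0n m)) e.
by apply/dyadic_index0; rewrite e.
Qed.

Lemma dyadic_cell_sub m x : hcube Q0 x -> dyadic_cell m x `<=` Q0.
Proof.
move=> xQ0 y yC i; have := yC i; rewrite /= mxE ffunE.
set a := corner Q0 ord0 i; set z := (x ord0 i - a) / mesh m; have h0 := mesh_gt0 m.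
have := xQ0 i; rewrite -/a => /andP[ax xa].
have z0 : 0 <= Num.floor z by rewrite floor_ge0 divr_ge0// ?subr_ge0// ltW.
have z1 : Num.floor z + 1 <= 2 ^+ m.
  rewrite lezD1 floor_lt_int ltr_pdivrMr// rmorphXn/= /mesh mulrCA mulfV ?mulr1 ?expf_neq0//.
  by rewrite ltrBlDl.
move=> /andP[yl yr]; apply/andP; split.
  apply: le_trans yl; rewrite lerDl mulr_ge0 ?ler0z// ltW//.
apply: (le_trans yr); rewrite -addrA lerD2l -[X in _ + X]mulr1 -mulrDr.
rewrite /mesh -mulrA ler_piMr ?(ltW (side_gt0 _))// mulrC ler_pdivrMr ?exprn_gt0// mul1r.
by have := z1; rewrite -(ler_int R) intrD rmorphXn.
Qed.

Lemma dyadic_cell_dist m x y i : dyadic_index m y = dyadic_index m x ->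
  `|x ord0 i - y ord0 i| < mesh m.
Proof.
move=> /dyadic_cellP/(_ i) /= ; rewrite mxE.
have /(_ i) /= : hcube (dyadic_cell m x) x by apply/dyadic_cellP.
rewrite mxE => /andP[h1 h2] /andP[h3 h4]; rewrite ltr_norml; apply/andP; split; lra.
Qed.

Lemma le_measure_integral_bigcup (F : nat -> set 'rV[R]_n) E (w : 'rV[R]_n -> \bar R) :
  (forall j, measurable (F j)) -> trivIset setT F -> measurable E ->
  measurable_fun (\bigcup_j F j) w -> (forall x, 0 <= w x)%E ->
  (forall j, mu (E `&` F j) <= \int[mu]_(x in F j) w x)%E ->
  (mu (E `&` \bigcup_j F j) <= \int[mu]_(x in \bigcup_j F j) w x)%E.
Proof.
move=> mF tF mE mw w0 H; rewrite ge0_integral_bigcup//.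
rewrite setI_bigcupr; apply: (@le_trans _ _ (\sum_(0 <= j <oo) mu (E `&` F j))%E).
  apply: measure_sigma_subadditive => //.
  - by move=> j; exact: measurableI.
  - by apply: bigcup_measurable => j _; exact: measurableI.
by apply: lee_nneseries => j _; [move=> _; exact: measure_ge0|exact: H].
Qed.

(** Unions of half-open dyadic cubes of generation m. *)
Definition saturated m S := forall x y, S x -> dyadic_index m y = dyadic_index m x -> S y.

(** Indices range over a countable type, so its encoding by natural numbers
    enumerates the cubes that make up S; numbers that encode no such cube give
    empty pieces. *)
Lemma saturated_pieces m S : saturated m S ->
  exists F : nat -> set 'rV[R]_n, [/\ S = \bigcup_j F j, trivIset setT F &
    forall j, F j = set0 \/ exists2 x, S x & F j = hcube (dyadic_cell m x)].
Proof.
move=> sat; exists (fun j => S `&` [set x | pickle (dyadic_index m x) = j]); split.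
- by apply/seteqP; split=> [x Sx|x [j _ []]//]; exists (pickle (dyadic_index m x)).
- by move=> i j _ _ [x [[_ /= <-] [_ /= <-]]].
- move=> j; have [[x [Sx xj]]|nx] := pselect (exists x, S x /\ pickle (dyadic_index m x) = j).
    right; exists x => //; apply/seteqP; split=> y.
      move=> [Sy /= yj]; apply/dyadic_cellP; apply: (pcan_inj pickleK); by rewrite yj.
    move=> /dyadic_cellP e; split; first exact: sat e.
    by rewrite /= e.
  left; apply/seteqP; split=> // x [Sx xj]; by apply: nx; exists x.
Qed.

Lemma saturated_measurable m S : saturated m S -> measurable S.
Proof.
move=> /saturated_pieces[F [-> _ FE]]; apply: bigcup_measurable => j _.
by case: (FE j) => [->//|[x _ ->]]; exact: measurable_hcube.
Qed.

Lemma saturated_domination m S E (w : 'rV[R]_n -> \bar R) :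
  saturated m S -> measurable E -> measurable_fun S w -> (forall x, 0 <= w x)%E ->
  (forall x, S x -> (mu (E `&` hcube (dyadic_cell m x)) <=
                     \int[mu]_(y in hcube (dyadic_cell m x)) w y)%E) ->
  (mu (E `&` S) <= \int[mu]_(x in S) w x)%E.
Proof.
move=> sat mE mw w0 H.
have [F [SE tF FE]] := saturated_pieces sat.
rewrite SE; apply: le_measure_integral_bigcup => //.
- by move=> j; case: (FE j) => [->//|[x _ ->]]; exact: measurable_hcube.
- by rewrite -SE.
- move=> j; case: (FE j) => [->|[x Sx ->]]; last exact: H.
  by rewrite setI0 measure0 integral_set0.
Qed.

Lemma cvg_mesh : mesh @ \oo --> (0 : R).
Proof.
rewrite (_ : mesh = geometric (side Q0) 2^-1); last first.
  by apply/funext => m; rewrite /mesh /geometric /= exprVn.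
by apply: cvg_geometric; rewrite ger0_norm// invf_lt1// ltr1n.
Qed.

(** Fine dyadic cubes that meet the box stay within distance [mesh m] of it, so
    their total volume tends to the volume of the box, and the density bound
    on cubes passes to the box. *)
Lemma box_density F (t : R) u v : 0 <= t -> measurable F -> F `<=` hcube Q0 ->
  (forall m x, hcube Q0 x ->
     mu (F `&` hcube (dyadic_cell m x)) <= (t * mesh m ^+ n)%:E)%E ->
  (mu (F `&` box u v) <= (t * box_vol u v)%:E)%E.
Proof.
move=> t0 mF FQ0 dens.
pose V m := \prod_(i < n) (Num.max 0 (v ord0 i - u ord0 i) + 2 * mesh m).
have VC : t * V m @[m --> \oo] --> t * box_vol u v.
  apply: cvgMr; apply: cvg_big => [|i _]; first exact: mul_continuous.
  rewrite -[X in _ --> X]addr0; apply: cvgD; first exact: cvg_cst.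
  by rewrite -(mulr0 (2 : R)); apply: cvgMr; exact: cvg_mesh.
suff H m : (mu (F `&` box u v) <= (t * V m)%:E)%E.
  have fin : mu (F `&` box u v) \is a fin_num.
    by rewrite ge0_fin_numE ?measure_ge0// (le_lt_trans (H 0%N))// ltry.
  rewrite -(fineK fin) lee_fin; apply: (cvgr_to_ge VC); near=> m.
  by rewrite -lee_fin fineK.
pose S := [set x | hcube Q0 x /\ exists2 y, box u v y & dyadic_index m y = dyadic_index m x].
have satS : saturated m S.
  move=> x y [xQ0 [z zb zx]] yx; split; first exact: dyadic_index_hcube yx.
  by exists z => //; rewrite zx yx.
have mS := saturated_measurable satS.
pose u' : 'rV[R]_n := \row_i (u ord0 i - mesh m).
pose v' : 'rV[R]_n := \row_i (v ord0 i + mesh m).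
have Sbox : S `<=` box u' v'.
  move=> x [xQ0 [y yb e]] i; have := dyadic_cell_dist i e; have /andP[uy yv] := yb i.
  by rewrite !mxE ltr_norml => /andP[h1 h2]; apply/andP; split; lra.
apply: (@le_trans _ _ (mu (F `&` S))).
  apply: le_measure; rewrite ?inE; [|exact: measurableI|].
    by apply: measurableI => //; exact: measurable_box.
  move=> x [Fx xb]; split => //; split; first exact: FQ0.
  by exists x.
apply: (@le_trans _ _ (\int[mu]_(x in S) (cst t%:E x))%E).
  apply: (saturated_domination satS) => // x [xQ0 _].
  apply: (le_trans (dens m x xQ0)).
  have mC := measurable_hcube (dyadic_cell m x).
  by rewrite (integral_cst mu mC t%:E) /= lebesgue_hcube.
rewrite integral_cst//= EFinM; apply: lee_wpmul2l; first by rewrite lee_fin.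
apply: (@le_trans _ _ (mu (box u' v'))).
  by apply: le_measure; rewrite ?inE//; exact: measurable_box.
rewrite lebesgue_box lee_fin; apply: ler_prod => i _; rewrite le_max lexx /= !mxE ge_max.
have h0 := mesh_gt0 m.
have := le_max 0 0 (v ord0 i - u ord0 i).
have := le_max (v ord0 i - u ord0 i) 0 (v ord0 i - u ord0 i).
rewrite !lexx orbT /= => h1 h2; apply/andP; split; lra.
Unshelve. all: by end_near. Qed.

(** For every cover of F by boxes, [box_density] gives mu F <= t * (total volume
    of the cover).  Taking the infimum over covers, mu F <= t * mu F. *)
Lemma density_null F (t : R) : 0 < t < 1 -> measurable F -> F `<=` hcube Q0 ->
  (forall m x, hcube Q0 x ->
     mu (F `&` hcube (dyadic_cell m x)) <= (t * mesh m ^+ n)%:E)%E ->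
  mu F = 0%E.
Proof.
move=> /andP[t0 t1] mF FQ0 dens.
have fin : mu F \is a fin_num.
  rewrite ge0_fin_numE ?measure_ge0//; apply: (@le_lt_trans _ _ (mu (hcube Q0))).
    by apply: le_measure; rewrite ?inE//; exact: measurable_hcube.
  by rewrite lebesgue_hcube ltry.
suff : ((t^-1)%:E * mu F <= mu F)%E.
  rewrite -(fineK fin) -EFinM lee_fin => H; congr EFin.
  have F0 : 0 <= fine (mu F) by apply/fine_ge0/measure_ge0.
  apply/eqP; rewrite eq_le F0 andbT; move: H.
  rewrite mulrC ler_pdivrMr// => H; have := mulr_ge0 F0 (ltW t0).
  nra.
apply: le_ereal_inf_tmp => _ [D [u [v [cov ->]]]].
rewrite lee_pdivrMl//.
pose c (k : nat) : \bar R := if k \in D then (box_vol (u k) (v k))%:E else 0%E.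
have c0 (k : nat) : (0 <= c k)%E by rewrite /c; case: ifP => // _; rewrite lee_fin box_vol_ge0.
rewrite esum_mkcond -nneseries_esumT; last exact: c0.
rewrite -nneseriesZl; last by move=> k _; exact: c0.
pose G (k : nat) := if k \in D then F `&` box (u k) (v k) else set0.
have mG (k : nat) : measurable (G k).
  by rewrite /G; case: ifP => // _; apply: measurableI => //; exact: measurable_box.
apply: (@le_trans _ _ (\sum_(0 <= k <oo) mu (G k))%E).
  apply: measure_sigma_subadditive => // x Fx.
  have [k Dk xk] := cov x Fx; exists k => //.
  by rewrite /G mem_set.
apply: lee_nneseries => k _; first by move=> _; exact: measure_ge0.
rewrite /G /c; case: ifP => _; last by rewrite measure0 mule0.
by apply: box_density => //; exact: ltW.
Qed.

(** Calderon-Zygmund stopping.  The maximal dyadic cubes in which E has density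
    more than t are disjoint, they cover E up to a null set by [density_null],
    and E has density at most 2 ^ n * t in each, because the parent was not
    selected.  Hence a bound for E' by an integral need only be checked on
    cubes where the density of E is between t and 2 ^ n * t. *)
Lemma stopping_domination E E' (t : R) (w : 'rV[R]_n -> \bar R) :
  0 < t < 1 -> measurable E -> measurable E' -> E' `<=` E -> E `<=` Q0 ->
  (mu E <= (t * side Q0 ^+ n)%:E)%E ->
  measurable_fun Q0 w -> (forall x, 0 <= w x)%E ->
  (forall Q : cube R n, Q `<=` Q0 -> ((t * side Q ^+ n)%:E <= mu (E `&` Q))%E ->
     (mu (E `&` Q) <= (2 ^+ n * t * side Q ^+ n)%:E)%E ->
     (mu (E' `&` Q) <= \int[mu]_(x in Q) w x)%E) ->
  (mu E' <= \int[mu]_(x in Q0) w x)%E.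
Proof.
move=> t01 mE mE' E'E EQ0 Esmall mw w0 H.
pose dense m x := ((t * mesh m ^+ n)%:E < mu (E `&` hcube (dyadic_cell m x)))%E.
have denseE m x y : dyadic_index m y = dyadic_index m x -> dense m y = dense m x.
  by move=> e; rewrite /dense /dyadic_cell e.
(* T m is the union of the selected cubes of generation m. *)
pose T m := [set x | [/\ hcube Q0 x, dense m x & forall j, (j < m)%N -> ~~ dense j x]].
have satT m : saturated m (T m).
  move=> x y [xQ0 dx ndx] e; split.
  - exact: dyadic_index_hcube e.
  - by rewrite (denseE _ _ _ e).
  - by move=> j jm; rewrite (denseE _ _ _ (dyadic_index_le (ltnW jm) e)) ndx.
have mT m := saturated_measurable (satT m).
have tT : trivIset setT T.
  move=> i j _ _ [x [[_ di ni] [_ dj nj]]].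
  case: (ltngtP i j) => // ij; first by have := nj _ ij; rewrite di.
  by have := ni _ ij; rewrite dj.
have TQ0 m : T m `<=` Q0 by move=> x [xQ0 _ _]; exact: hcube_sub.
have UTQ0 : \bigcup_m T m `<=` Q0 by move=> x [m _]; exact: TQ0.
have mQ0 := measurable_cube Q0.
have mh := measurable_hcube Q0.
have mU : measurable (\bigcup_m T m) by apply: bigcup_measurable => m _; exact: mT.
have step m : (mu (E' `&` T m) <= \int[mu]_(x in T m) w x)%E.
  apply: (saturated_domination (satT m)) => //.
    by apply: measurable_funS mw => //; exact: TQ0.
  move=> x [xQ0 dx ndx].
  pose Q := dyadic_cell m x.
  have QQ0 : Q `<=` Q0 by exact: dyadic_cell_sub.
  have mQ := measurable_cube Q; have mhQ := measurable_hcube Q.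
  have wQ : measurable_fun Q w by apply: measurable_funS mw.
  have QhQ : Q `\` (Q `\` hcube Q) = hcube Q by rewrite setDD setIidr//; exact: hcube_sub.
  rewrite lebesgue_setI_hcube// -/Q.
  have <- : (\int[mu]_(y in Q) w y = \int[mu]_(y in hcube Q) w y)%E.
    rewrite -[in RHS]QhQ; apply: ge0_negligible_integral => //.
      exact: measurableD.
    exact: lebesgue_cubeDhcube.
  apply: H => //.
    by rewrite -lebesgue_setI_hcube//; exact: ltW.
  (* Generation 0 is Q0 itself, whose density is too small for selection. *)
  case: m @Q dx ndx QQ0 mQ mhQ wQ QhQ => [|m] Q dx ndx QQ0 mQ mhQ wQ QhQ.
    move: dx; rewrite /dense ltNge; case/negP; rewrite /mesh expr0 divr1.
    by apply: le_trans Esmall; apply: le_measure; rewrite ?inE//; exact: measurableI.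
  have := ndx m (ltnSn m); rewrite /dense -leNgt => Hm.
  rewrite -lebesgue_setI_hcube//.
  apply: (@le_trans _ _ (mu (E `&` hcube (dyadic_cell m x)))).
    apply: le_measure; rewrite ?inE; [exact: measurableI| |].
      by apply: measurableI => //; exact: measurable_hcube.
    by apply: setIS => y /dyadic_cellP/dyadic_indexS e; apply/dyadic_cellP.
  by apply: (le_trans Hm); rewrite lee_fin meshS exprMn mulrCA mulrA.
pose F := (E `&` hcube Q0) `\` \bigcup_m T m.
have mF : measurable F by apply: measurableD => //; exact: measurableI.
have null : mu F = 0%E.
  apply: (@density_null F t) => //; first by move=> x [[]].
  move=> m x xQ0.
  have mC := measurable_hcube (dyadic_cell m x).
  have [[j jm dj]|nd] := pselect (exists2 j, (j <= m)%N & dense j x).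
    rewrite (_ : _ `&` _ = set0).
      rewrite measure0 lee_fin mulr_ge0//; first by case/andP: t01 => /ltW.
      by rewrite exprn_ge0// ltW// mesh_gt0.
    apply/seteqP; split=> // y [[[Ey yQ0] nT]] /dyadic_cellP e; apply: nT.
    have ej := dyadic_index_le jm e.
    have ex : exists j, dense j y by exists j; rewrite (denseE _ _ _ ej).
    exists (ex_minn ex) => //; case: ex_minnP => l dl lmin; split=> // i il.
    by apply/negP => /lmin; rewrite leqNgt il.
  apply: (@le_trans _ _ (mu (E `&` hcube (dyadic_cell m x)))).
    apply: le_measure; rewrite ?inE; [exact: measurableI|exact: measurableI|].
    by apply: setSI => y [[]].
  by rewrite leNgt; apply/negP => dm; apply: nd; exists m.
rewrite -(setIidl (subset_trans E'E EQ0)) -lebesgue_setI_hcube//.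
apply: (@le_trans _ _ (mu (E' `&` \bigcup_m T m))).
  rewrite -[leRHS]adde0 -null.
  apply: (@le_trans _ _ (mu ((E' `&` \bigcup_m T m) `|` F))).
    apply: le_measure; rewrite ?inE.
    - exact: measurableI.
    - by apply: measurableU => //; exact: measurableI.
    - move=> x [E'x xQ0]; have [xU|xU] := pselect ((\bigcup_m T m) x); first by left.
      by right; split=> //; split=> //; exact: E'E.
  by apply: measureU2 => //; exact: measurableI.
apply: (@le_trans _ _ (\int[mu]_(x in \bigcup_m T m) w x)%E).
  apply: le_measure_integral_bigcup => //.
  exact: measurable_funS mw.
by apply: ge0_subset_integral.
Qed.

End dyadic.

(** * Real-variable inequalities *)

Lemma powR_le_base (R : realType) (r x y : R) :
  0 <= r -> 0 <= x -> x <= y -> x `^ r <= y `^ r.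
Proof. by move=> r0 x0 xy; apply: ge0_ler_powR; rewrite ?nnegrE// (le_trans x0). Qed.

Lemma powR_le1D (R : realType) (z a : R) : 0 <= z -> 0 <= a <= 1 -> z `^ a <= 1 + z.
Proof.
move=> z0 /andP[a0 a1]; have [z1|z1] := leP z 1.
  by rewrite (@le_trans _ _ (1 `^ a)) ?powR_le_base// powR1 lerDl.
by rewrite (@le_trans _ _ z) ?lerDr// -[leRHS]powRr1// ler_powR// ltW.
Qed.

(** The weighted mean (V ^ (1 - a)) (Y ^ a) is at most a combination of V and Y.
    The weights are balanced for summation: over a family of pairs (V, Y) with
    sums W and G, each of the two terms in the bracket sums to W. *)
Lemma powR_young (R : realType) (a V W G Y : R) :
  0 <= a <= 1 -> 0 < V -> 0 < W -> 0 < G -> 0 <= Y ->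
  V * (V^-1 * Y) `^ a <= (G / W) `^ a * (V + W / G * Y).
Proof.
move=> a01 V0 W0 G0 Y0.
have r0 : 0 < G / W by rewrite divr_gt0.
have -> : V^-1 * Y = (G / W) * (V^-1 * Y * (W / G)).
  by field; rewrite !gt_eqF.
have z0 : 0 <= V^-1 * Y * (W / G) by rewrite !mulr_ge0 ?invr_ge0// ltW.
rewrite powRM ?(ltW r0)// mulrCA ler_pM2l ?powR_gt0//.
apply: (@le_trans _ _ (V * (1 + V^-1 * Y * (W / G)))).
  by rewrite ler_pM2l// powR_le1D.
rewrite le_eqVlt; apply/orP; left; apply/eqP; field; rewrite !gt_eqF//.
Qed.

Lemma powR_homogeneity (R : realType) (G W u v : R) : 0 < G -> 0 < W ->
  W `^ u * (G / W) `^ v * W = G `^ v * W `^ (u - v + 1).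
Proof.
move=> G0 W0.
have W00 (r : R) : (r == 0) ==> (W != 0) by rewrite (gt_eqF W0) implybT.
rewrite powRM ?invr_ge0 ?ltW// -[in W^-1](powRr1 (ltW W0)) -powRN -powRrM mulN1r.
rewrite (powRD (W00 _)) (powRD (W00 _)) (powRr1 (ltW W0)); ring.
Qed.

(** If lam t <= M t ^ (- q), the hypothesis gives
    lam (2 t) <= K M ^ (1 - 1 / q) t ^ (- q), which is at most
    M (2 t) ^ (- q) as soon as M ^ (1 / q) >= 2 ^ q K.  For t <= 2 t0 the bound
    holds because lam <= V0 and M >= (2 t0) ^ q V0; doubling then reaches every
    t. *)
Lemma weak_decay_iteration (R : realType) (lam : R -> R) (q K V0 t0 : R) :
  0 < q -> 0 < t0 -> 0 <= K -> 0 <= V0 -> 0 <= 1 - q^-1 ->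
  (forall t, 0 <= lam t <= V0) ->
  (forall t, t0 <= t -> lam (2 * t) <= K / t * lam t `^ (1 - q^-1)) ->
  exists2 M, 0 < M & forall t, 0 < t -> lam t <= M * t `^ (- q).
Proof.
move=> q0 t00 K0 V00 r0 lamV dec.
have [M [M0 M1 M2]] : exists M, [/\ 0 < M, (2 * t0) `^ q * V0 <= M & (2 `^ q * K) `^ q <= M].
  have A0 : 0 <= (2 * t0) `^ q * V0 by rewrite mulr_ge0 ?powR_ge0.
  have B0 : 0 <= (2 `^ q * K) `^ q by rewrite powR_ge0.
  exists ((2 * t0) `^ q * V0 + (2 `^ q * K) `^ q + 1); split; lra.
exists M => //.
have M3 : 2 `^ q * K <= M `^ q^-1.
  have k0 : 0 <= 2 `^ q * K by rewrite mulr_ge0 ?powR_ge0.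
  have <- : ((2 `^ q * K) `^ q) `^ q^-1 = 2 `^ q * K.
    by rewrite -powRrM mulfV ?powRr1// gt_eqF.
  by apply: powR_le_base M2; rewrite ?powR_ge0// invr_ge0 ltW.
have step k t : 0 < t -> t <= 2 ^+ k * t0 -> lam t <= M * t `^ (- q).
  elim: k t => [|k IH] t tt0; first rewrite expr0 mul1r => tle.
    have /andP[_ lamt] := lamV t; apply: (le_trans lamt).
    rewrite powRN ler_pdivlMr ?powR_gt0// mulrC; apply: le_trans M1.
    apply: ler_wpM2r => //; apply: powR_le_base; lra.
  move=> tle; have [ht|ht] := leP t (2 * t0).
    have /andP[_ lamt] := lamV t; apply: (le_trans lamt).
    rewrite powRN ler_pdivlMr ?powR_gt0// mulrC; apply: le_trans M1.
    by apply: ler_wpM2r => //; apply: powR_le_base => //; exact: ltW.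
  have [s ts] : exists s, t = 2 * s by exists (t / 2); field.
  have s0 : 0 < s by lra.
  have st0 : t0 <= s by lra.
  have lams : lam s <= M * s `^ (- q).
    by apply: IH => //; move: tle; rewrite exprS ts; lra.
  rewrite {1}ts; apply: (le_trans (dec s st0)).
  have /andP[lams0 _] := lamV s.
  apply: (@le_trans _ _ (K / s * (M * s `^ (- q)) `^ (1 - q^-1))).
    apply: ler_wpM2l; first by rewrite divr_ge0 ?(ltW s0).
    exact: powR_le_base.
  rewrite powRM ?powR_ge0 ?(ltW M0)// -powRrM.
  have -> : - q * (1 - q^-1) = - q + 1 by field; rewrite gt_eqF.
  rewrite [s `^ (- q + 1)]powRD; last by rewrite (gt_eqF s0) implybT.
  rewrite powRr1 ?(ltW s0)// ts powRM ?(ltW s0)//.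
  have -> : K / s * (M `^ (1 - q^-1) * (s `^ (- q) * s)) =
      (K * M `^ (1 - q^-1)) * s `^ (- q) by field; rewrite gt_eqF.
  rewrite [2 `^ _ * _]mulrC mulrA [M * _ * _]mulrAC ler_wpM2r ?powR_ge0//.
  rewrite powRN ler_pdivlMr ?powR_gt0//.
  have -> : K * M `^ (1 - q^-1) * 2 `^ q = (2 `^ q * K) * M `^ (1 - q^-1) by ring.
  apply: (@le_trans _ _ (M `^ q^-1 * M `^ (1 - q^-1))).
    by rewrite ler_wpM2r ?powR_ge0.
  rewrite -powRD; last by apply/implyP => _; rewrite gt_eqF.
  by rewrite addrC subrK powRr1// ltW.
move=> t tt0.
have [k kP] : exists k, t <= 2 ^+ k * t0.
  exists (Num.bound (t / t0)).
  rewrite -ler_pdivrMr//; apply: ltW; apply: (lt_le_trans (archi_boundP _)).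
    by rewrite divr_ge0 ?ltW.
  by rewrite -natrX ler_nat ltnW// ltn_expl.
exact: step kP.
Qed.

(** * Level sets and the decay of the distribution function *)

Section weak_type.
Context {R : realType} {n : nat}.
Local Notation mu := (@lebesgue_rV R n).
Implicit Types (Q : cube R n) (f g : 'rV[R]_n -> R) (A B : set 'rV[R]_n).

Lemma chebyshev_dev Q f A (c r : R) : L1 Q f -> measurable A -> A `<=` Q ->
  (forall x, A x -> r <= `|f x - c|) ->
  (r%:E * mu A <= (\int[mu]_(x in Q) `|f x - c|)%:E)%E.
Proof.
move=> fQ mA AQ rA; have dQ := L1_dev c fQ; have mQ := measurable_cube Q.
have mf : measurable_fun Q (fun x => `|f x - c|%:E) by exact: measurable_int dQ.
rewrite -(integral_cst mu mA r%:E) -(L1_EFin dQ).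
apply: (@le_trans _ _ (\int[mu]_(x in A) `|f x - c|%:E)%E).
  have [r0|r0] := leP 0 r.
    by apply: ge0_le_integral => //=; exact: measurable_funS mf.
  rewrite integral_cst//; apply: (@le_trans _ _ 0%E).
    by rewrite mule_le0_ge0// lee_fin ltW.
  by apply: integral_ge0 => x _; rewrite lee_fin.
by apply: ge0_subset_integral.
Qed.

(** If |c| <= 3 t / 2, then c is at distance at least t / 2 from f on A; otherwise
    it is so on B, which is at least as large as A. *)
Lemma level_sets_dev Q f A B (c t : R) : L1 Q f -> 0 <= t ->
  measurable A -> A `<=` Q -> measurable B -> B `<=` Q -> (mu A <= mu B)%E ->
  (forall x, A x -> 2 * t <= `|f x|) -> (forall x, B x -> `|f x| <= t) ->
  ((t / 2)%:E * mu A <= (\int[mu]_(x in Q) `|f x - c|)%:E)%E.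
Proof.
move=> fQ t0 mA AQ mB BQ AB fA fB.
have [ct|ct] := leP `|c| (3 / 2 * t).
  apply: chebyshev_dev => // x Ax; have := fA x Ax; have := lerB_dist (f x) c; lra.
apply: (@le_trans _ _ ((t / 2)%:E * mu B)%E).
  by apply: lee_wpmul2l => //; rewrite lee_fin divr_ge0.
apply: chebyshev_dev => // x Bx; have := fB x Bx; rewrite distrC.
have := lerB_dist c (f x); lra.
Qed.

Definition level Q f (t : R) := Q `&` [set x | t < `|f x|].

Lemma measurable_level Q f t : measurable_fun Q f -> measurable (level Q f t).
Proof.
move=> mf; have mQ := measurable_cube Q.
have mfn : measurable_fun Q (fun x => `|f x|) by exact: measurableT_comp.
rewrite /level (_ : [set x | _] = (fun x => `|f x|) @^-1` `]t, +oo[%classic).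
  by apply: mfn => //; exact: measurable_itv.
by apply/seteqP; split=> x /=; rewrite in_itv/= andbT.
Qed.

Lemma level_fin Q f t : measurable_fun Q f -> mu (level Q f t) \is a fin_num.
Proof.
move=> mf; rewrite ge0_fin_numE ?measure_ge0//; apply: le_lt_trans (cube_fin Q).
apply: le_measure; rewrite ?inE; [|exact: measurable_cube|exact: subIsetl].
exact: measurable_level.
Qed.

End weak_type.

Section decay.
Context {R : realType} {n : nat} (Q0 : cube R n).
Local Notation mu := (@lebesgue_rV R n).
Implicit Types (Q : cube R n) (f g : 'rV[R]_n -> R).

Lemma integral_stopping_weight Q (E : set 'rV[R]_n) (v : 'rV[R]_n -> R) (a b : R) :
  Q `<=` Q0 -> measurable E -> L1 Q0 v -> (forall x, 0 <= v x) -> 0 <= a -> 0 <= b ->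
  (\int[mu]_(x in Q) (a * \1_E x + b * v x)%:E =
   a%:E * mu (E `&` Q) + (b * \int[mu]_(x in Q) v x)%:E)%E.
Proof.
move=> QQ0 mE vQ0 v0 a0 b0; have mQ := measurable_cube Q; have vQ := L1_sub QQ0 vQ0.
have mv : measurable_fun Q (EFin \o v) by exact: measurable_int vQ.
have m1 : measurable_fun Q (fun x => (\1_E x)%:E : \bar R).
  by apply/measurable_EFinP; exact: measurable_indic.
under eq_integral do rewrite EFinD !EFinM.
rewrite ge0_integralD//; last 4 first.
- by move=> x _; rewrite -EFinM lee_fin mulr_ge0.
- exact: measurable_funeM.
- by move=> x _; rewrite -EFinM lee_fin mulr_ge0.
- exact: measurable_funeM.
rewrite ge0_integralZl_EFin// ge0_integralZl_EFin//; last by move=> x _; rewrite lee_fin.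
by rewrite integral_indic// L1_EFin// EFinM.
Qed.

(** The good-lambda inequality.  Let W be the measure of the level set at height
    t, divided by th; it bounds the total volume of the stopped cubes.  By
    [powR_young] with exponent 1 / p, and because the side of a stopped cube Q
    is at most W ^ (1 / n), the integral of |f - f_Q| over Q is at most
    K (|Q| + (W / G) times the integral of |g| ^ p over Q), where
    K = c W ^ (1 / n) (G / W) ^ (1 / p).  Each of the two terms sums to at most
    K W over the stopped cubes.  The summand 1 in G keeps it positive when g
    vanishes. *)
Lemma S_class_level_decay (p q c t : R) f g : (0 < n)%N ->
  1 <= p -> q^-1 = p^-1 - n%:R^-1 ->
  L1 Q0 f -> Lp p Q0 g -> 0 < c ->
  (forall Q, Q `<=` Q0 ->
    mean_osc Q f <= c * side Q * (avg Q (fun x => `|g x| `^ p)) `^ p^-1) ->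
  0 < t ->
  let th := (2 ^+ n.+1)^-1 in
  let lam s := fine (mu (level Q0 f s)) in
  let G := \int[mu]_(x in Q0) (`|g x| `^ p) + 1 in
  lam t <= th * side Q0 ^+ n ->
  lam (2 * t) <= (4 * c * G `^ p^-1 * (th^-1) `^ (1 - q^-1)) / t * lam t `^ (1 - q^-1).
Proof.
move=> n0 p1 qE fQ0 gLp c0 osc t0 th lam G lamt.
have th0 : 0 < th by rewrite invr_gt0 exprn_gt0.
have th1 : th < 1 by rewrite invf_lt1 ?exprn_gt0// exprn_egt1// ltr1n.
pose v x := `|g x| `^ p.
have v0 x : 0 <= v x by exact: powR_ge0.
have vQ0 : L1 Q0 v := powR_L1 gLp.
have mQ0 := measurable_cube Q0.
have mf : measurable_fun Q0 f by apply/measurable_EFinP; exact: measurable_int fQ0.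
set E := level Q0 f t; set E' := level Q0 f (2 * t).
have mE : measurable E by exact: measurable_level.
have mE' : measurable E' by exact: measurable_level.
have finE : mu E \is a fin_num by exact: level_fin.
have finE' : mu E' \is a fin_num by exact: level_fin.
have E'E : E' `<=` E.
  by move=> x [Qx /= fx]; split=> //=; apply: le_lt_trans fx; lra.
have EQ0 : E `<=` Q0 by exact: subIsetl.
have lamE : (lam t)%:E = mu E by rewrite fineK.
have rhs0 : 0 <= (4 * c * G `^ p^-1 * (th^-1) `^ (1 - q^-1)) / t.
  by rewrite divr_ge0 ?mulr_ge0 ?powR_ge0// ltW.
have [l0|] := eqVneq (lam t) 0.
  have -> : lam (2 * t) = 0.
    apply/eqP; rewrite eq_le fine_ge0 ?measure_ge0// andbT -l0 fine_le//.
    by apply: le_measure; rewrite ?inE.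
  by rewrite mulr_ge0// powR_ge0.
move=> lneq.
have lgt : 0 < lam t by rewrite lt_neqAle eq_sym lneq fine_ge0 ?measure_ge0.
pose W := th^-1 * lam t.
have W0 : 0 < W by rewrite mulr_gt0// invr_gt0.
have Gv : \int[mu]_(x in Q0) v x <= G by rewrite /G lerDl.
have G0 : 0 < G.
  by rewrite /G ltr_wpDl//; apply: Rintegral_ge0 => x _; exact: powR_ge0.
pose K := c * W `^ n%:R^-1 * (G / W) `^ p^-1.
have K0 : 0 <= K by rewrite !mulr_ge0 ?powR_ge0// ltW.
pose a := 2 / t * K * th^-1; pose b := 2 / t * K * (W / G).
have t20 : 0 <= 2 / t by rewrite divr_ge0 ?ltW.
have tK0 : 0 <= 2 / t * K by exact: mulr_ge0.
have a0 : 0 <= a by apply: mulr_ge0 => //; rewrite invr_ge0 ltW.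
have b0 : 0 <= b by apply: mulr_ge0 => //; rewrite divr_ge0 ?(ltW W0) ?(ltW G0).
have p0 : 0 < p by exact: lt_le_trans p1.
have pi01 : 0 <= p^-1 <= 1.
  by rewrite invr_ge0 (ltW p0) invf_le1.
have main : (mu E' <= \int[mu]_(x in Q0) (a * \1_E x + b * v x)%:E)%E.
  apply: (@stopping_domination _ _ Q0 E E' th) => //.
  - by rewrite th0.
  - by rewrite -lamE lee_fin.
  - apply/measurable_EFinP; apply: measurable_funD; apply: measurable_funM => //.
    by apply/measurable_EFinP; exact: measurable_int vQ0.
  - by move=> x; rewrite lee_fin addr_ge0// mulr_ge0.
  move=> Q QQ0 dens sparse.
  have mQ := measurable_cube Q; have fQ := L1_sub QQ0 fQ0; have vQ := L1_sub QQ0 vQ0.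
  rewrite integral_stopping_weight//.
  have V0 := vol_gt0 Q; set V := side Q ^+ n in V0 dens sparse *.
  pose Y := \int[mu]_(x in Q) v x.
  have Y0 : 0 <= Y by apply: Rintegral_ge0 => x _.
  have mEQ : measurable (E `&` Q) by exact: measurableI.
  have mE'Q : measurable (E' `&` Q) by exact: measurableI.
  have EQfin : mu (E `&` Q) \is a fin_num.
    by rewrite ge0_fin_numE ?measure_ge0//; apply: le_lt_trans sparse _; rewrite ltry.
  have E'EQ : (mu (E' `&` Q) <= mu (E `&` Q))%E.
    by apply: le_measure; rewrite ?inE//; exact: setSI.
  have E'Qfin : mu (E' `&` Q) \is a fin_num.
    rewrite ge0_fin_numE ?measure_ge0//; apply: le_lt_trans E'EQ _.
    by rewrite -ge0_fin_numE ?measure_ge0.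
  have VW : V <= W.
    rewrite /W mulrC ler_pdivlMr// mulrC -lee_fin lamE; apply: (le_trans dens).
    by apply: le_measure; rewrite ?inE//; exact: subIsetl.
  have half : 2 ^+ n * th = 2^-1.
    by rewrite /th exprS invfM mulrCA mulfV ?mulr1// expf_neq0.
  have devl : ((t / 2)%:E * mu (E' `&` Q) <= (\int[mu]_(x in Q) `|f x - avg Q f|)%:E)%E.
    apply: (@level_sets_dev _ _ Q f _ (Q `\` E)) => //.
    - exact: ltW.
    - exact: measurableD.
    - apply: (le_trans E'EQ); rewrite measureD//; last exact: cube_fin.
      rewrite (setIC Q E) /= lebesgue_cube leeBrDr// -(fineK EQfin) -EFinD lee_fin.
      move: sparse; rewrite -(fineK EQfin) lee_fin half -/V; lra.
    - by move=> x [[_ /= /ltW]].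
    - move=> x [Qx nEx]; rewrite leNgt; apply/negP => tx; apply: nEx; split=> //.
      exact: QQ0.
  have oscQ : \int[mu]_(x in Q) `|f x - avg Q f| <= K * (V + W / G * Y).
    rewrite avgE -/(mean_osc Q f) -/V.
    apply: (@le_trans _ _ (V * (c * side Q * (V^-1 * Y) `^ p^-1))).
      rewrite ler_pM2l//; apply: le_trans (osc Q QQ0) _.
      by rewrite /avg fine_cube.
    have -> : V * (c * side Q * (V^-1 * Y) `^ p^-1) =
      c * side Q * (V * (V^-1 * Y) `^ p^-1) by ring.
    rewrite /K -[leRHS]mulrA; apply: ler_pM.
    - by rewrite mulr_ge0// ltW// side_gt0.
    - by rewrite mulr_ge0 ?powR_ge0// ltW.
    - rewrite ler_pM2l//.
      have <- : V `^ n%:R^-1 = side Q.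
        rewrite /V -powR_mulrn ?(ltW (side_gt0 Q))// -powRrM mulfV ?pnatr_eq0 -?lt0n//.
        by rewrite powRr1// ltW// side_gt0.
      by apply: powR_le_base VW; rewrite ?invr_ge0// ltW.
    exact: powR_young.
  rewrite -(fineK EQfin) -(fineK E'Qfin) -EFinM -EFinD lee_fin.
  move: devl; rewrite -(fineK E'Qfin) -EFinM lee_fin => devl.
  have Vle : V <= th^-1 * fine (mu (E `&` Q)).
    by rewrite mulrC ler_pdivlMr// mulrC -lee_fin fineK.
  have -> : fine (mu (E' `&` Q)) = 2 / t * (t / 2 * fine (mu (E' `&` Q))).
    by field; rewrite gt_eqF.
  have -> : a * fine (mu (E `&` Q)) + b * \int[mu]_(x in Q) v x =
      2 / t * (K * (th^-1 * fine (mu (E `&` Q)) + W / G * Y)).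
    by rewrite /a /b /Y; ring.
  rewrite ler_pM2l ?divr_gt0//; apply: (le_trans devl); apply: (le_trans oscQ).
  by rewrite ler_wpM2l// lerD2r.
move: main; rewrite integral_stopping_weight// (setIidl EQ0) -lamE -(fineK finE').
rewrite -EFinM -EFinD lee_fin => main; rewrite -/(lam (2 * t)) in main.
apply: (le_trans main).
have -> : a * lam t = 2 / t * K * W by rewrite /a /W mulrA.
have WGv : W / G * \int[mu]_(x in Q0) v x <= W.
  by rewrite -mulrA ler_piMr ?(ltW W0)// mulrC ler_pdivrMr// mul1r.
apply: (@le_trans _ _ (2 / t * K * W + 2 / t * K * W)).
  by rewrite lerD2l /b -[leLHS]mulrA ler_wpM2l// mulr_ge0// divr_ge0 ?ltW.
have e : W `^ n%:R^-1 * (G / W) `^ p^-1 * W =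
    G `^ p^-1 * (th^-1 `^ (1 - q^-1) * lam t `^ (1 - q^-1)).
  rewrite powR_homogeneity//; congr (_ * _).
  rewrite /W powRM ?invr_ge0 ?(ltW th0) ?(ltW lgt)//.
  by rewrite qE; congr (_ `^ _ * _ `^ _); ring.
have -> : 2 / t * K * W + 2 / t * K * W = 4 * c / t * (W `^ n%:R^-1 * (G / W) `^ p^-1 * W).
  by rewrite /K; field; rewrite gt_eqF.
rewrite e le_eqVlt; apply/orP; left; apply/eqP; field; rewrite gt_eqF//.
Qed.

End decay.

(** * Weak-type spaces *)

Section weak_space.
Context {R : realType} {n : nat} (Q0 : cube R n).
Local Notation mu := (@lebesgue_rV R n).
Implicit Types (f g : 'rV[R]_n -> R).

(** At s = (M / t) ^ (1 / q) the distribution function is at most t, so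
    s bounds the rearrangement at t, and s * t ^ (1 / q) = M ^ (1 / q). *)
Lemma weakL_of_level_bound (q M : R) f : 0 < q -> 0 < M -> measurable_fun Q0 f ->
  (forall t, 0 < t -> fine (mu (level Q0 f t)) <= M * t `^ (- q)) -> weakL q Q0 f.
Proof.
move=> q0 M0 mf bound; split=> //; apply: (@le_lt_trans _ _ (M `^ q^-1)%:E); last exact: ltry.
apply: ge_ereal_sup => _ [t /= t0 <-].
pose s := (M / t) `^ q^-1.
have Mt0 : 0 < M / t by rewrite divr_gt0.
have s0 : 0 < s by rewrite powR_gt0.
have ds : (distribution_fun Q0 f s <= t%:E)%E.
  rewrite -[distribution_fun _ _ _](fineK (level_fin s mf)) lee_fin.
  apply: (le_trans (bound s s0)); rewrite /s -powRrM mulrN mulVf ?gt_eqF//.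
  by rewrite powR_inv1 ?(ltW Mt0)// invf_div mulrC divfK// gt_eqF.
have rs : (rearrangement Q0 f t <= s%:E)%E.
  by apply: ereal_inf_lbound; exists s => //; split=> //; exact: ltW.
apply: (@le_trans _ _ (s%:E * (t `^ q^-1)%:E)%E).
  by apply: lee_wpmul2r => //; rewrite lee_fin powR_ge0.
rewrite -EFinM lee_fin /s -powRM ?(ltW t0) ?(ltW Mt0)//.
by rewrite divfK// gt_eqF.
Qed.

Lemma level_small f (e : R) : 0 < e -> L1 Q0 f ->
  exists2 t0, 0 < t0 & forall t, t0 <= t -> fine (mu (level Q0 f t)) <= e.
Proof.
move=> e0 fQ0.
have mf : measurable_fun Q0 f by apply/measurable_EFinP; exact: measurable_int fQ0.
pose I := \int[mu]_(x in Q0) `|f x - 0|.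
have I0 : 0 <= I by exact: Rintegral_ge0.
exists (I / e + 1); first by rewrite ltr_wpDl// divr_ge0// ltW.
move=> t t0t; have Ie : I / e <= t by apply: le_trans t0t; rewrite lerDl.
have t0 : 0 < t by apply: lt_le_trans t0t; rewrite ltr_wpDl// divr_ge0// ltW.
have := @chebyshev_dev R n Q0 f (level Q0 f t) 0 t fQ0 (measurable_level t mf).
rewrite -(fineK (level_fin t mf)) -EFinM lee_fin => H.
rewrite -(ler_pM2l t0); apply: le_trans (H _ _) _.
- exact: subIsetl.
- by move=> x [_ /= /ltW]; rewrite subr0.
- by rewrite -ler_pdivrMr.
Qed.

Theorem S_class_weakL (p q : R) f : (0 < n)%N -> 1 <= p -> p < n%:R ->
  q^-1 = p^-1 - n%:R^-1 -> S_class p Q0 f -> weakL q Q0 f.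
Proof.
move=> n0 p1 pn qE [fQ0 [c [g [c0 gLp osc]]]].
have p0 : 0 < p by exact: lt_le_trans p1.
have nR0 : 0 < n%:R :> R by rewrite ltr0n.
have qi0 : 0 < q^-1 by rewrite qE subr_gt0 ltf_pV2.
have q0 : 0 < q by rewrite -invr_gt0.
have q1 : 0 <= 1 - q^-1.
  have : p^-1 <= 1 by rewrite invf_le1.
  have : 0 < n%:R^-1 :> R by rewrite invr_gt0.
  rewrite qE; lra.
have mf : measurable_fun Q0 f by apply/measurable_EFinP; exact: measurable_int fQ0.
have V0 := vol_gt0 Q0.
have th0 : 0 < (2 ^+ n.+1)^-1 :> R by rewrite invr_gt0 exprn_gt0.
have [t0 t00 small] := level_small (mulr_gt0 th0 V0) fQ0.
have [|||||M M0 bound] := @weak_decay_iteration R (fun s => fine (mu (level Q0 f s))) q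
  (4 * c * (\int[mu]_(x in Q0) (`|g x| `^ p) + 1) `^ p^-1 *
    ((2 ^+ n.+1)^-1^-1) `^ (1 - q^-1)) (side Q0 ^+ n) t0 q0 t00.
- by rewrite !mulr_ge0 ?powR_ge0// ltW.
- exact: ltW.
- exact: q1.
- move=> t; rewrite fine_ge0 ?measure_ge0//= -lee_fin (fineK (level_fin t mf)) -lebesgue_cube.
  apply: le_measure; rewrite ?inE; [|exact: measurable_cube|exact: subIsetl].
  exact: measurable_level.
- move=> t t0t; apply: S_class_level_decay => //; [exact: lt_le_trans t0t|exact: small].
exact: weakL_of_level_bound bound.
Qed.

End weak_space.

Theorem theorem3p1 (R : realType) (n : nat) (Q0 : cube R n) :
  (forall p pstar : R, 1 < p -> p < n%:R -> pstar^-1 = p^-1 - n%:R^-1 ->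
     forall f : 'rV[R]_n -> R, S_class p Q0 f -> weakL pstar Q0 f) /\
  ((1 < n)%N ->
     (forall f : 'rV[R]_n -> R, S_class n%:R Q0 f -> GaRo_infty Q0 f) /\
     GaRo_infty Q0 = BMO Q0).
Proof.
split=> [p q p1 pn qE f fS|n1]; last first.
  split; last exact: GaRo_infty_BMO.
  by move=> f fS; rewrite GaRo_infty_BMO; apply: S_class_BMO => //; exact: ltnW.
apply: S_class_weakL fS => //; last exact: ltW.
by rewrite -(ltr0n R) (lt_trans _ pn)// (lt_trans _ p1).
Qed.
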